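(* There is a set $A \subseteq \mathbb{N}$ with asymptotic density $d(A) = 0$ such that $R(A) = \{a/a' : a,a'\in A\}$ is dense in $\mathbb{Q}_p$ for every prime $p$.
   Context: $\mathbb{N} = \{1,2,\ldots\}$. The asymptotic density is $d(A)=\lim_{n\to\infty}|A\cap[1,n]|/n$ (when it exists). $\mathbb{Q}_p$ denotes the field of $p$-adic numbers with the $p$-adic metric. *)

(* Defs.v *)
From HB Require Import structures.
From mathcomp Require Import all_boot all_order all_algebra.
From mathcomp Require Import generic_quotient ring_quotient finmap zify ring lra.
From mathcomp Require Import all_classical all_reals all_analysis.

Set Implicit Arguments.
Unset Strict Implicit.
Unset Printing Implicit Defensive.

Import Order.TTheory GRing.Theory Num.Theory.
Import numFieldNormedType.Exports.

Local Open Scope classical_set_scope.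
Local Open Scope ring_scope.

Definition asymptotic_density (R : realType) (A : set nat) (d : R) : Prop :=
  ((#|` fset_set (A `&` [set k | (1 <= k <= n)%N]) |)%:R / n%:R : R)
    @[n --> \oo] --> d.

Definition ratio_set (A : set nat) : set rat :=
  [set a%:R / a'%:R | a in A & a' in A].

(** The p-adic absolute value on the rationals: p ^ (- v_p x), where
    v_p x = logn p (numq x) - logn p (denq x). *)
Definition padic_abs (p : nat) (x : rat) : rat :=
  if x == 0 then 0
  else p%:R ^+ logn p `|denq x| / p%:R ^+ logn p `|numq x|.

Section PadicAbs.
Variables (p : nat) (p_pr : prime p).
Implicit Types x y e : rat.
Local Notation "`| x |_p" := (padic_abs p x) (format "`| x |_p").

Let p0 : 0 < p%:R :> rat. Proof. by rewrite ltr0n prime_gt0. Qed.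
Let pX0 n : 0 < p%:R ^+ n :> rat. Proof. exact: exprn_gt0. Qed.
Let pXn0 n : p%:R ^+ n != 0 :> rat. Proof. exact: lt0r_neq0. Qed.

Lemma padic_abs_frac (a b : int) : a != 0 -> b != 0 ->
  `|a%:~R / b%:~R|_p = p%:R ^+ logn p `|b| / p%:R ^+ logn p `|a|.
Proof.
move=> a0 b0; set x : rat := a%:~R / b%:~R.
have a0' : a%:~R != 0 :> rat by rewrite intr_eq0.
have b0' : b%:~R != 0 :> rat by rewrite intr_eq0.
have x0 : x != 0 by rewrite mulf_neq0 ?invr_eq0.
rewrite /padic_abs (negbTE x0).
have d0 : (denq x)%:~R != 0 :> rat by rewrite intr_eq0 denq_eq0.
have E : a * denq x = numq x * b.
  apply/eqP; rewrite -(eqr_int rat) !intrM.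
  have := divq_num_den x; rewrite {3}/x => /eqP.
  by rewrite eqr_div // => /eqP ->.
have {}E : (logn p `|a| + logn p `|denq x|)%N
         = (logn p `|numq x| + logn p `|b|)%N.
  by rewrite -!lognM ?absz_gt0 ?numq_eq0 ?denq_eq0 // -!abszM E.
apply/eqP; rewrite eqr_div ?pXn0 // -!exprD; apply/eqP; congr (_ ^+ _).
by rewrite addnC E addnC.
Qed.

Lemma padic_abs0 : `|0|_p = 0. Proof. by rewrite /padic_abs eqxx. Qed.

Lemma padic_abs_gt0 x : (0 < `|x|_p) = (x != 0).
Proof.
rewrite /padic_abs; case: eqP => [_|_]; first by rewrite ltxx.
by rewrite divr_gt0.
Qed.

Lemma padic_abs_ge0 x : 0 <= `|x|_p.
Proof.
by have [->|x0] := eqVneq x 0; rewrite ?padic_abs0// ltW// padic_abs_gt0.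
Qed.

Lemma padic_abs_eq0 x : (`|x|_p == 0) = (x == 0).
Proof.
by have := padic_abs_gt0 x; rewrite lt0r padic_abs_ge0 andbT => /negb_inj.
Qed.

Lemma padic_absN x : `|- x|_p = `|x|_p.
Proof. by rewrite /padic_abs oppr_eq0 numqN denqN abszN. Qed.

Lemma padic_absB x y : `|x - y|_p = `|y - x|_p.
Proof. by rewrite -opprB padic_absN. Qed.

Lemma padic_absM x y : `|x * y|_p = `|x|_p * `|y|_p.
Proof.
have [->|x0] := eqVneq x 0; first by rewrite mul0r padic_abs0 mul0r.
have [->|y0] := eqVneq y 0; first by rewrite mulr0 padic_abs0 mulr0.
have nx : numq x != 0 by rewrite numq_eq0.
have ny : numq y != 0 by rewrite numq_eq0.
have dx : denq x != 0 by rewrite denq_eq0.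
have dy : denq y != 0 by rewrite denq_eq0.
have -> : x * y = (numq x * numq y)%:~R / (denq x * denq y)%:~R.
  by rewrite !intrM -mulf_div !divq_num_den.
rewrite padic_abs_frac ?mulf_neq0 // !abszM !lognM ?absz_gt0 // !exprD.
by rewrite /padic_abs (negbTE x0) (negbTE y0) mulf_div.
Qed.

Lemma padic_abs1 : `|1|_p = 1.
Proof. by rewrite /padic_abs oner_eq0 /= logn1 expr0 divr1. Qed.

Lemma padic_absV x : `|x^-1|_p = `|x|_p^-1.
Proof.
have [->|x0] := eqVneq x 0; first by rewrite !(invr0, padic_abs0).
apply: (mulfI (x := `|x|_p)); first by rewrite padic_abs_eq0.
by rewrite -padic_absM !divff ?padic_abs1 ?padic_abs_eq0.
Qed.

Lemma padic_absD x y : `|x + y|_p <= Num.max `|x|_p `|y|_p.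
Proof.
have [->|x0] := eqVneq x 0; first by rewrite add0r le_max lexx orbT.
have [->|y0] := eqVneq y 0; first by rewrite addr0 le_max lexx.
have [s0|s0] := eqVneq (x + y) 0.
  by rewrite s0 padic_abs0 le_max padic_abs_ge0.
pose a := numq x * denq y; pose b := numq y * denq x.
pose d := denq x * denq y.
have dx : (denq x)%:~R != 0 :> rat by rewrite intr_eq0 denq_eq0.
have dy : (denq y)%:~R != 0 :> rat by rewrite intr_eq0 denq_eq0.
have d0 : d != 0 by rewrite mulf_neq0 ?denq_eq0.
have a0 : a != 0 by rewrite mulf_neq0 ?denq_eq0 ?numq_eq0.
have b0 : b != 0 by rewrite mulf_neq0 ?denq_eq0 ?numq_eq0.
have Ex : x = a%:~R / d%:~R.
  by rewrite !intrM -[LHS]divq_num_den; field; rewrite dx dy.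
have Ey : y = b%:~R / d%:~R.
  by rewrite !intrM -[LHS]divq_num_den; field; rewrite dx dy.
have Es : x + y = (a + b)%:~R / d%:~R by rewrite intrD mulrDl -Ex -Ey.
have c0 : a + b != 0.
  by apply: contra_neq s0; rewrite Es => ->; rewrite mul0r.
rewrite Es Ex Ey !padic_abs_frac //.
set k := minn (logn p `|a|) (logn p `|b|).
have dvd z : z != 0 -> (k <= logn p `|z|)%N = (p ^ k %| `|z|)%N.
  by move=> z0; rewrite pfactor_dvdn ?absz_gt0.
have kab : (k <= logn p `|(a + b)%R|)%N.
  rewrite dvd // -[X in (X %| _)%N]/(`|(p ^ k)%N%:Z|%N).
  rewrite -dvdzE rpredD // dvdzE /= -dvd //.
  - by rewrite geq_minl.
  - by rewrite geq_minr.
have p1 : 1 <= p%:R :> rat by rewrite ler1n prime_gt0.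
rewrite le_max; have [h|h] := leqP (logn p `|a|) (logn p `|b|).
- apply/orP; left; rewrite ler_pM2l // lef_pV2 ?posrE // ler_weXn2l //.
  by move: kab; rewrite /k (minn_idPl h).
- apply/orP; right; rewrite ler_pM2l // lef_pV2 ?posrE // ler_weXn2l //.
  by move: kab; rewrite /k (minn_idPr (ltnW h)).
Qed.

Lemma padic_absD_lt x y e : `|x|_p < e -> `|y|_p < e -> `|x + y|_p < e.
Proof.
by move=> xe ye; apply: le_lt_trans (padic_absD x y) _; rewrite gt_max xe.
Qed.

Lemma padic_abs_isosceles x y : `|x - y|_p < `|y|_p -> `|x|_p = `|y|_p.
Proof.
move=> h; apply/eqP; rewrite eq_le; apply/andP; split.
  have := padic_absD (x - y) y; rewrite subrK => /le_trans; apply.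
  by rewrite ge_max (ltW h) lexx.
have := padic_absD (y - x) x; rewrite subrK le_max padic_absB.
by rewrite leNgt h.
Qed.

End PadicAbs.

Section PadicCauchy.
Variables (p : nat) (p_pr : prime p).
Local Notation "`| x |_p" := (padic_abs p x) (format "`| x |_p").

Definition padic_cauchy of prime p : {pred nat -> rat} :=
  fun u => `[< forall e : rat, 0 < e -> exists N : nat,
    forall m n, (N <= m)%N -> (N <= n)%N -> `|u m - u n|_p < e >].

Definition padic_null (u : nat -> rat) : Prop :=
  forall e : rat, 0 < e -> exists N : nat,
    forall n, (N <= n)%N -> `|u n|_p < e.

Lemma padic_cauchyP u : reflect
  (forall e : rat, 0 < e -> exists N : nat,
    forall m n, (N <= m)%N -> (N <= n)%N -> `|u m - u n|_p < e)
  (u \in padic_cauchy p_pr).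
Proof. exact: asboolP. Qed.

Lemma padic_cauchy_bounded u : u \in padic_cauchy p_pr ->
  exists2 M : rat, 0 < M & exists N : nat,
    forall n, (N <= n)%N -> `|u n|_p < M.
Proof.
move=> /padic_cauchyP /(_ 1 ltr01) [N uN].
have u0 := padic_abs_ge0 p_pr (u N).
exists (`|u N|_p + 1); first lra.
exists N => n Nn; rewrite -[u n](subrK (u N)).
by apply: (padic_absD_lt p_pr); [have := uN _ _ Nn (leqnn N); lra | lra].
Qed.

Lemma padic_cauchy_nonnull u : u \in padic_cauchy p_pr -> ~ padic_null u ->
  exists2 c : rat, 0 < c & exists N : nat,
    forall n, (N <= n)%N -> `|u n|_p = c.
Proof.
move=> /padic_cauchyP uC /existsNP [e /not_implyP [e0 /forallNP une]].
have [N uN] := uC _ e0.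
have /existsNP [m /not_implyP [Nm /negP]] := une N.
rewrite -leNgt => em.
exists `|u m|_p; first exact: lt_le_trans em.
exists N => n Nn; apply: (padic_abs_isosceles p_pr).
exact: lt_le_trans (uN _ _ Nn Nm) em.
Qed.

Lemma padic_nullM u v : u \in padic_cauchy p_pr -> padic_null v ->
  padic_null (u * v).
Proof.
move=> /padic_cauchy_bounded [M M0 [N uN]] v0 e e0.
have [N' vN] := v0 (e / M) (divr_gt0 e0 M0).
exists (maxn N N') => n; rewrite geq_max => /andP[/uN ? /vN ?].
rewrite fctE padic_absM //.
have -> : e = M * (e / M) by field; rewrite gt_eqF.
by apply: ltr_pM => //; exact: padic_abs_ge0.
Qed.

Lemma padic_nullD u v : padic_null u -> padic_null v -> padic_null (u + v).
Proof.
move=> u0 v0 e e0; have [N uN] := u0 _ e0; have [N' vN] := v0 _ e0.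
exists (maxn N N') => n; rewrite geq_max => /andP[/uN ? /vN ?].
exact: (padic_absD_lt p_pr).
Qed.

Lemma padic_cauchy_subring_closed : subring_closed (padic_cauchy p_pr).
Proof.
split=> [|u v /padic_cauchyP uC /padic_cauchyP vC|u v uC vC].
- apply/padic_cauchyP => e e0; exists 0%N => m n _ _.
  by rewrite subrr padic_abs0.
- apply/padic_cauchyP => e e0; have [N uN] := uC _ e0; have [N' vN] := vC _ e0.
  exists (maxn N N') => m n; rewrite !geq_max => /andP[? ?] /andP[? ?].
  have -> : (u - v) m - (u - v) n = (u m - u n) + (v n - v m).
    by rewrite !fctE; ring.
  by apply: (padic_absD_lt p_pr); [exact: uN|exact: vN].
- apply/padic_cauchyP => e e0.
  have [M M0 [N1 uM]] := padic_cauchy_bounded uC.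
  have [M' M'0 [N2 vM]] := padic_cauchy_bounded vC.
  move: uC vC => /padic_cauchyP uC /padic_cauchyP vC.
  have [N3 uN] := uC _ (divr_gt0 e0 M'0); have [N4 vN] := vC _ (divr_gt0 e0 M0).
  exists (maxn (maxn N1 N2) (maxn N3 N4)) => m n.
  rewrite !geq_max => /andP[/andP[? ?] /andP[? ?]] /andP[/andP[? ?] /andP[? ?]].
  have -> : (u * v) m - (u * v) n = u m * (v m - v n) + (u m - u n) * v n.
    by rewrite !fctE; ring.
  apply: (padic_absD_lt p_pr); rewrite padic_absM //.
  + have -> : e = M * (e / M) by field; rewrite gt_eqF.
    by apply: ltr_pM; rewrite ?padic_abs_ge0 ?uM ?vN.
  + have -> : e = (e / M') * M' by field; rewrite gt_eqF.
    by apply: ltr_pM; rewrite ?padic_abs_ge0 ?uN ?vM.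
Qed.

HB.instance Definition _ :=
  GRing.isSubringClosed.Build (nat -> rat) (padic_cauchy p_pr)
    padic_cauchy_subring_closed.

End PadicCauchy.

Record cauchy_seq (p : nat) (p_pr : prime p) := CauchySeq {
  cauchy_val :> nat -> rat;
  cauchy_valP : cauchy_val \in padic_cauchy p_pr }.

HB.instance Definition _ p (p_pr : prime p) :=
  [isSub for @cauchy_val p p_pr].
HB.instance Definition _ p (p_pr : prime p) :=
  [Choice of cauchy_seq p_pr by <:].
HB.instance Definition _ p (p_pr : prime p) :=
  [SubChoice_isSubComNzRing of cauchy_seq p_pr by <:].

Definition null_seq (p : nat) (p_pr : prime p) : {pred cauchy_seq p_pr} :=
  fun u => `[< padic_null p u >].
Arguments null_seq {p} p_pr _.

Lemma null_seq_idealr_closed p (p_pr : prime p) :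
  idealr_closed (null_seq p_pr).
Proof.
split=> [||a u v /asboolP u0 /asboolP v0].
- by apply/asboolP => e e0; exists 0%N => n _; rewrite padic_abs0.
- apply/negP => /asboolP /(_ 1 ltr01) [N /(_ N (leqnn N))].
  by rewrite padic_abs1 // ltxx.
- apply/asboolP; apply: (padic_nullD p_pr) => //.
  by apply: (@padic_nullM _ p_pr) => //; exact: cauchy_valP.
Qed.

HB.instance Definition _ p (p_pr : prime p) :=
  isIdealr.Build (cauchy_seq p_pr) (null_seq p_pr)
    (null_seq_idealr_closed p_pr).

(** The completion of the rationals for the p-adic absolute value: p-adic Cauchy
    sequences of rationals modulo null sequences. *)
Definition Qp (p : nat) (p_pr : prime p) : Type :=
  {ideal_quot (null_seq p_pr)}.

HB.instance Definition _ p (p_pr : prime p) := GRing.ComNzRing.on (Qp p_pr).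

Section QpTheory.
Variables (p : nat) (p_pr : prime p).
Local Notation "`| x |_p" := (padic_abs p x) (format "`| x |_p").
Local Notation K := (Qp p_pr).
Local Open Scope quotient_scope.

Definition Qp_class (u : cauchy_seq p_pr) : K :=
  \pi_{ideal_quot (null_seq p_pr)} u.
Definition Qp_repr (x : K) : cauchy_seq p_pr :=
  repr (x : {ideal_quot (null_seq p_pr)}).

Lemma Qp_reprK x : Qp_class (Qp_repr x) = x. Proof. exact: reprK. Qed.

Lemma Qp_classD u v : Qp_class (u + v) = Qp_class u + Qp_class v.
Proof. exact: pi_addr. Qed.
Lemma Qp_classN u : Qp_class (- u) = - Qp_class u.
Proof. exact: pi_oppr. Qed.
Lemma Qp_classM u v : Qp_class (u * v) = Qp_class u * Qp_class v.
Proof. exact: pi_mulr. Qed.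
Lemma Qp_class0 : Qp_class 0 = 0. Proof. exact: pi_zeror. Qed.
Lemma Qp_class1 : Qp_class 1 = 1. Proof. exact: pi_oner. Qed.

Lemma Qp_class_eq u v : Qp_class u = Qp_class v <-> padic_null p (u - v).
Proof.
split.
- move=> /eqP; rewrite -[_ == _]/(u == v %[mod {ideal_quot null_seq p_pr}]).
  by rewrite -Quotient.idealrBE => /asboolP.
- move=> h; apply/eqP.
  rewrite -[_ == _]/(u == v %[mod {ideal_quot null_seq p_pr}]).
  by rewrite -Quotient.idealrBE; apply/asboolP.
Qed.

Lemma Qp_class_eq0 u : Qp_class u = 0 <-> padic_null p u.
Proof.
by rewrite -Qp_class0 Qp_class_eq; split => + e e0 => /(_ _ e0) [N h];
  exists N => n /h; rewrite /GRing.add/= /GRing.add/= subr0.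
Qed.

Lemma Qp_inverse_exists (x : K) : x != 0 -> exists y, y * x = 1.
Proof.
rewrite -[x]Qp_reprK; set u := Qp_repr x => /eqP; rewrite Qp_class_eq0 => u0.
have [c c0 [N uN]] := padic_cauchy_nonnull (cauchy_valP u) u0.
have nz n : (N <= n)%N -> u n != 0.
  by move=> /uN h; rewrite -(padic_abs_gt0 p_pr) h.
have vC : (fun n => (u n)^-1) \in padic_cauchy p_pr.
  apply/padic_cauchyP => e e0.
  have /padic_cauchyP /(_ (e * c * c)) [|N' uN'] := cauchy_valP u.
    by rewrite !mulr_gt0.
  exists (maxn N N') => m n; rewrite !geq_max => /andP[Nm N'm] /andP[Nn N'n].
  have -> : (u m)^-1 - (u n)^-1 = (u n - u m) / (u m * u n).
    by field; rewrite !nz.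
  rewrite padic_absM // padic_absV // padic_absM // !uN // ltr_pdivrMr ?mulr_gt0 //.
  by rewrite mulrA uN'.
exists (Qp_class (CauchySeq vC)); rewrite -Qp_classM -Qp_class1 Qp_class_eq.
move=> e e0; exists N => n Nn.
have -> : ((CauchySeq vC * u - 1) : cauchy_seq p_pr) n = (u n)^-1 * u n - 1.
  by [].
by rewrite mulVf ?nz // subrr padic_abs0.
Qed.

Definition Qp_inv (x : K) : K :=
  if x == 0 then 0 else xget 0 [set y | y * x = 1].

Lemma Qp_mulVf x : x != 0 -> Qp_inv x * x = 1.
Proof.
move=> x0; rewrite /Qp_inv (negbTE x0).
by have [y yx] := Qp_inverse_exists x0; case: xgetP => [z _ //|/(_ y)].
Qed.

Lemma Qp_inv0 : Qp_inv 0 = 0. Proof. by rewrite /Qp_inv eqxx. Qed.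

End QpTheory.

HB.instance Definition _ p (p_pr : prime p) :=
  GRing.ComNzRing_isField.Build (Qp p_pr)
    (@Qp_mulVf p p_pr) (@Qp_inv0 p p_pr).

Section QpAbs.
Variables (p : nat) (p_pr : prime p).
Local Notation "`| x |_p" := (padic_abs p x) (format "`| x |_p").
Local Notation K := (Qp p_pr).

(** The limit is taken in [rat]: the values of the p-adic absolute value are 0
    and the powers of p, so the limit of a convergent sequence of such values is
    again rational. *)
Definition is_abs_limit (u : nat -> rat) (l : rat) : Prop :=
  forall e : rat, 0 < e -> exists N : nat,
    forall n, (N <= n)%N -> `| `|u n|_p - l | < e.

Definition Qp_abs (x : K) : rat :=
  xget 0 [set l | is_abs_limit (Qp_repr x) l].

Lemma is_abs_limit_unique u l l' :
  is_abs_limit u l -> is_abs_limit u l' -> l = l'.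
Proof.
move=> h h'; apply/eqP; apply: contraT => ll'.
have e0 : 0 < `|l - l'| / 2 by rewrite divr_gt0 ?normr_gt0 ?subr_eq0.
have [N /(_ (maxn N _) (leq_maxl _ _)) hN] := h _ e0.
have [N' /(_ (maxn _ N') (leq_maxr _ _)) hN'] := h' _ e0.
have := hN N'; have := hN' N; set a := `|u _|_p => h1 h2.
have : `|l - l'| <= `|a - l'| + `|a - l|.
  have -> : l - l' = (a - l') - (a - l) by ring.
  exact: ler_normB.
lra.
Qed.

Lemma is_abs_limit_const u c N :
  (forall n, (N <= n)%N -> `|u n|_p = c) -> is_abs_limit u c.
Proof. by move=> h e e0; exists N => n /h ->; rewrite subrr normr0. Qed.

Lemma is_abs_limit0 u : is_abs_limit u 0 <-> padic_null p u.
Proof.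
by split=> h e e0; have [N hN] := h _ e0; exists N => n /hN;
  rewrite subr0 ger0_norm ?padic_abs_ge0.
Qed.

Lemma Qp_absE (u : cauchy_seq p_pr) l :
  is_abs_limit u l -> Qp_abs (Qp_class u) = l.
Proof.
move=> ul; set v := Qp_repr (Qp_class u).
have uv : padic_null p (v - u) by apply/Qp_class_eq; rewrite Qp_reprK.
suff vl : is_abs_limit v l.
  rewrite /Qp_abs -/v; case: xgetP => [l' _ /is_abs_limit_unique|/(_ l)//].
  exact.
have [u0|nu0] := pselect (padic_null p u).
  have /(is_abs_limit_unique ul) -> := (is_abs_limit0 _).2 u0.
  apply/is_abs_limit0; rewrite -[X in padic_null _ X](subrK (u : nat -> rat)).
  exact: (padic_nullD p_pr uv u0).
have [c c0 [N uN]] := padic_cauchy_nonnull (cauchy_valP u) nu0.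
have /(is_abs_limit_unique ul) -> := is_abs_limit_const uN.
have [N' vN] := uv _ c0.
apply: (@is_abs_limit_const _ _ (maxn N N')) => n.
rewrite geq_max => /andP[Nn N'n]; rewrite -(uN _ Nn).
by apply: (padic_abs_isosceles p_pr); rewrite (uN _ Nn); exact: vN.
Qed.

Lemma Qp_abs_spec (u : cauchy_seq p_pr) :
  is_abs_limit u (Qp_abs (Qp_class u)).
Proof.
suff [l hl] : exists l, is_abs_limit u l by rewrite (Qp_absE hl).
have [/is_abs_limit0 u0|nu0] := pselect (padic_null p u); first by exists 0.
have [c c0 [N uN]] := padic_cauchy_nonnull (cauchy_valP u) nu0.
by exists c; exact: is_abs_limit_const uN.
Qed.

Lemma Qp_abs_tail (u : cauchy_seq p_pr) : Qp_class u != 0 ->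
  0 < Qp_abs (Qp_class u) /\
  exists N, forall n, (N <= n)%N -> `|u n|_p = Qp_abs (Qp_class u).
Proof.
move=> /eqP; rewrite Qp_class_eq0 => nu0.
have [c c0 [N uN]] := padic_cauchy_nonnull (cauchy_valP u) nu0.
by rewrite (Qp_absE (is_abs_limit_const uN)); split => //; exists N.
Qed.

Lemma Qp_abs0 : Qp_abs (0 : K) = 0.
Proof.
rewrite -Qp_class0; apply: Qp_absE; apply: (@is_abs_limit_const _ _ 0) => n _.
exact: padic_abs0.
Qed.

Lemma Qp_abs_gt0 (x : K) : (0 < Qp_abs x) = (x != 0).
Proof.
have [->|] := eqVneq x 0; first by rewrite Qp_abs0 ltxx.
by rewrite -[x]Qp_reprK => /Qp_abs_tail [].
Qed.

Lemma Qp_abs_ge0 (x : K) : 0 <= Qp_abs x.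
Proof.
by have [->|x0] := eqVneq x 0; rewrite ?Qp_abs0// ltW// Qp_abs_gt0.
Qed.

Lemma Qp_abs_eq0 (x : K) : Qp_abs x = 0 -> x = 0.
Proof.
by move=> h; apply/eqP; apply: contraT; rewrite -Qp_abs_gt0 h ltxx.
Qed.

Lemma Qp_absN (x : K) : Qp_abs (- x) = Qp_abs x.
Proof.
rewrite -[x]Qp_reprK -Qp_classN; apply: Qp_absE => e e0.
have [N h] := Qp_abs_spec (Qp_repr x) e0; exists N => n /h.
by rewrite -[(- Qp_repr x : cauchy_seq p_pr) n]/(- Qp_repr x n) padic_absN.
Qed.

Lemma Qp_absD (x y : K) : Qp_abs (x + y) <= Num.max (Qp_abs x) (Qp_abs y).
Proof.
have [->|x0] := eqVneq x 0; first by rewrite add0r le_max lexx orbT.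
have [->|y0] := eqVneq y 0; first by rewrite addr0 le_max lexx.
have [->|] := eqVneq (x + y) 0; first by rewrite Qp_abs0 le_max Qp_abs_ge0.
move: x0 y0; rewrite -[x]Qp_reprK -[y]Qp_reprK -Qp_classD.
move=> /Qp_abs_tail [_ [N hN]] /Qp_abs_tail [_ [N' hN']].
move=> /Qp_abs_tail [_ [N'' hN'']].
set n := maxn N (maxn N' N'').
rewrite -(hN n) ?leq_maxl // -(hN' n) ?leq_max ?leqnn ?orbT //.
rewrite -(hN'' n) ?leq_max ?leqnn ?orbT //.
exact: padic_absD.
Qed.

Lemma Qp_absM (x y : K) : Qp_abs (x * y) = Qp_abs x * Qp_abs y.
Proof.
have [->|x0] := eqVneq x 0; first by rewrite mul0r Qp_abs0 mul0r.
have [->|y0] := eqVneq y 0; first by rewrite mulr0 Qp_abs0 mulr0.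
have := mulf_neq0 x0 y0.
move: x0 y0; rewrite -[x]Qp_reprK -[y]Qp_reprK -Qp_classM.
move=> /Qp_abs_tail [_ [N hN]] /Qp_abs_tail [_ [N' hN']].
move=> /Qp_abs_tail [_ [N'' hN'']].
set n := maxn N (maxn N' N'').
rewrite -(hN n) ?leq_maxl // -(hN' n) ?leq_max ?leqnn ?orbT //.
rewrite -(hN'' n) ?leq_max ?leqnn ?orbT //.
exact: padic_absM.
Qed.

Definition Qp_dist (x y : K) : rat := Qp_abs (x - y).

Lemma Qp_distxx x : Qp_dist x x = 0.
Proof. by rewrite /Qp_dist subrr Qp_abs0. Qed.

Lemma Qp_dist_positivity x y : Qp_dist x y = 0 -> x = y.
Proof. by move=> /Qp_abs_eq0 /eqP; rewrite subr_eq0 => /eqP. Qed.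

Lemma Qp_dist_sym x y : Qp_dist x y = Qp_dist y x.
Proof. by rewrite /Qp_dist -opprB Qp_absN. Qed.

Lemma Qp_dist_triangle y x z : Qp_dist x z <= Qp_dist x y + Qp_dist y z.
Proof.
rewrite /Qp_dist -[x - z](subrKA y).
apply: le_trans (Qp_absD _ _) _.
by rewrite ge_max lerDl lerDr !Qp_abs_ge0.
Qed.

HB.instance Definition _ := isMetric.Build rat K
  Qp_distxx Qp_dist_positivity Qp_dist_sym Qp_dist_triangle.

Lemma cauchy_cst_subproof (q : rat) : (fun=> q) \in padic_cauchy p_pr.
Proof.
by apply/padic_cauchyP => e e0; exists 0%N => m n _ _; rewrite subrr padic_abs0.
Qed.
Definition cauchy_cst (q : rat) : cauchy_seq p_pr :=
  CauchySeq (cauchy_cst_subproof q).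

Lemma Qp_class_nat n : Qp_class (cauchy_cst n%:R) = n%:R.
Proof.
elim: n => [|n IH].
  by rewrite [RHS]mulr0n -Qp_class0; congr Qp_class; exact: val_inj.
rewrite -addn1 [RHS]natrD -IH -[1%:R]Qp_class1 -Qp_classD natrD.
by congr Qp_class; exact: val_inj.
Qed.

Lemma Qp_class_int (z : int) : Qp_class (cauchy_cst z%:~R) = z%:~R.
Proof.
case: z => n; first exact: Qp_class_nat.
rewrite NegzE !mulrNz -[n.+1%:~R in RHS]Qp_class_nat -Qp_classN.
by congr Qp_class; exact: val_inj.
Qed.

(** The canonical embedding of the rationals sends q to the class of the
    constant sequence q, and is isometric with dense image. *)
Lemma Qp_class_rat (q : rat) : Qp_class (cauchy_cst q) = ratr q.
Proof.
have d0 : Qp_class (cauchy_cst (denq q)%:~R) != 0 :> K.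
  rewrite -Qp_abs_gt0 (@Qp_absE _ `|(denq q)%:~R|_p).
    by rewrite padic_abs_gt0 // intr_eq0 denq_eq0.
  exact: (@is_abs_limit_const _ _ 0).
rewrite /ratr -!Qp_class_int; apply: (mulIf d0); rewrite mulfVK //.
rewrite -Qp_classM; congr Qp_class; apply: val_inj; apply/funext => n.
exact: esym (numqE q).
Qed.

Lemma Qp_abs_rat (q : rat) : Qp_abs (ratr q : K) = `|q|_p.
Proof.
by rewrite -Qp_class_rat; apply: Qp_absE; exact: (@is_abs_limit_const _ _ 0).
Qed.

Lemma Qp_rat_approx (x : K) (e : rat) : 0 < e ->
  exists q : rat, Qp_dist x (ratr q) < e.
Proof.
move=> e0; set u := Qp_repr x; have e2 : 0 < e / 2 by lra.
have /padic_cauchyP /(_ _ e2) [N uN] := cauchy_valP u.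
exists (u N); rewrite /Qp_dist -[x]Qp_reprK -/u -Qp_class_rat -Qp_classN.
rewrite -Qp_classD; set v := u - _.
have [N' vN] := Qp_abs_spec v e2.
have vE : v (maxn N N') = u (maxn N N') - u N by [].
have := vN _ (leq_maxr N N'); rewrite vE => h1.
have h2 := uN _ _ (leq_maxl N N') (leqnn N).
move: h1; rewrite ltr_norml => /andP[h1 _]; lra.
Qed.

End QpAbs.

Lemma Qp_ballE p (p_pr : prime p) (x : Qp p_pr) (e : rat) :
  ball x e = [set y | Qp_abs (x - y) < e].
Proof. exact: ballEmdist. Qed.

(* Main.v *)
Require Import Defs.
From mathcomp Require Import all_boot all_order all_algebra.
From mathcomp Require Import finmap zify ring lra.
From mathcomp Require Import all_classical all_reals all_analysis.

(** The set [A] of all [a * n ^ 4] with [1 <= a <= n] has at most [sqrt N]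
    elements up to [N], since both [a] and [n] are at most the fourth root of
    [N]. Choosing a common [n >= a, b] shows that every positive rational [a / b]
    is a quotient of elements of [A], and the positive rationals are already
    dense in each [Qp]: adding to [q] the number [p ^ k * (q ^ 2 + 1)] makes it
    positive and moves it by an arbitrarily small [p]-adic distance. *)

Import Order.TTheory GRing.Theory Num.Theory.
Import numFieldNormedType.Exports.

Local Open Scope classical_set_scope.
Local Open Scope ring_scope.

Definition scaled_fourth_powers : set nat :=
  [set k | exists a n : nat, (0 < a <= n)%N /\ k = (a * n ^ 4)%N].

Lemma scaled_fourth_powers_gt0 k : scaled_fourth_powers k -> (0 < k)%N.
Proof.
by move=> [a [n [/andP[a0 an] ->]]]; rewrite muln_gt0 a0 expn_gt0 (leq_trans a0).
Qed.

Lemma fourth_root_floor N : exists m, (m ^ 4 <= N < m.+1 ^ 4)%N.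
Proof.
have P0 : exists m, (m ^ 4 <= N)%N by exists 0%N.
(* [ex_maxnP] needs an upper bound on the candidates; [m <= m ^ 4] supplies [N]. *)
have Pmax m : (m ^ 4 <= N)%N -> (m <= N)%N.
  by apply: leq_trans; case: m => // m; rewrite -[X in (X <= _)%N]expn1 leq_pexp2l.
have [m mN mmax] := ex_maxnP P0 Pmax.
by exists m; rewrite mN /= ltnNge; apply/negP => /mmax; rewrite ltnn.
Qed.

(** Squaring keeps the square-root bound inside [nat]: if [m] is the integer part of the fourth root
    of [N], at most [m * m] pairs occur, and [(m * m) ^ 2 = m ^ 4 <= N]. *)
Lemma card_scaled_fourth_powers N :
  (#|` fset_set (scaled_fourth_powers `&` [set k | (1 <= k <= N)%N])| ^ 2
     <= N)%N.
Proof.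
have [m /andP[mN Nm]] := fourth_root_floor N.
set S := _ `&` _.
have finS : finite_set S.
  by apply: (@sub_finite_set _ _ `I_N.+1) => // k [_ /= /andP[]].
pose s := [seq (a * n ^ 4)%N | a <- iota 1 m, n <- iota 1 m].
have cardS : (#|` fset_set S| <= m * m)%N.
  have <- : size s = (m * m)%N by rewrite size_allpairs !size_iota.
  apply: uniq_leq_size => [|k]; first exact: fset_uniq.
  rewrite in_fset_set // inE => -[[a [n [/andP[a0 an] ->]]] /= /andP[_ kN]].
  (* Here [n ^ 4 <= a * n ^ 4 <= N < m.+1 ^ 4]; then [a <= n] bounds [a] by [m] as well. *)
  have nm : (n <= m)%N.
    rewrite -ltnS -(@ltn_exp2r _ _ 4) //; apply: leq_ltn_trans Nm.
    by apply: leq_trans kN; rewrite leq_pmull.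
  by apply/allpairsP; exists (a, n); split=> //=; rewrite mem_iota; lia.
by apply: leq_trans mN; rewrite -[4%N]/(2 * 2)%N expnM leq_sqr -mulnn.
Qed.

Lemma density_scaled_fourth_powers (R : realType) :
  asymptotic_density scaled_fourth_powers (0 : R).
Proof.
apply/cvgrPdist_lt => e e0; near=> n.
(* This threshold gives [1 < e ^+ 2 * n], hence [c ^+ 2 <= n < (e * n) ^+ 2]. *)
have en : (e ^+ 2)^-1 < n%:R by near: n; exact: nbhs_infty_gtr.
have n0 : 0 < n%:R :> R by apply: lt_trans en; rewrite invr_gt0 exprn_gt0.
have := card_scaled_fourth_powers n; set c := #|` _| => cn.
have {}cn : c%:R ^+ 2 <= n%:R :> R by rewrite -natrX ler_nat.
rewrite sub0r normrN ger0_norm ?divr_ge0 // ltr_pdivrMr //.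
rewrite -(@ltr_pXn2r _ 2) ?nnegrE ?ler0n ?mulr_ge0 ?(ltW e0) //.
apply: le_lt_trans cn _; rewrite exprMn [n%:R ^+ 2]expr2 mulrA ltr_pMl //.
by rewrite mulrC -ltr_pdivrMr ?exprn_gt0 // div1r.
Unshelve. all: by end_near. Qed.

Lemma ratio_set_scaled_fourth_powers (q : rat) :
  0 < q -> ratio_set scaled_fourth_powers q.
Proof.
move=> q0; pose a := `|numq q|%N; pose b := `|denq q|%N.
have a0 : (0 < a)%N by rewrite absz_gt0 numq_eq0 gt_eqF.
have b0 : (0 < b)%N by rewrite absz_gt0 denq_eq0.
pose n := maxn a b.
have n0 : n%:R != 0 :> rat by rewrite pnatr_eq0 -lt0n leq_max a0.
have b0' : b%:R != 0 :> rat by rewrite pnatr_eq0 -lt0n.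
exists (a * n ^ 4)%N; first by exists a, n; rewrite a0 leq_maxl.
exists (b * n ^ 4)%N; first by exists b, n; rewrite b0 leq_maxr.
have -> : q = a%:R / b%:R.
  rewrite /a /b !natr_absz ger0_norm ?numq_ge0 ?ltW //.
  by rewrite gtr0_norm ?denq_gt0 // divq_num_den.
by rewrite !natrM; field; rewrite n0 b0'.
Qed.

Lemma padic_abs_pX p k : prime p -> padic_abs p (p%:R ^+ k) = p%:R ^- k.
Proof.
move=> p_pr; have p0 : (0 < p ^ k)%N by rewrite expn_gt0 prime_gt0.
have := @padic_abs_frac p p_pr (p ^ k)%N%:Z 1.
rewrite divr1 /= logn1 expr0 pfactorK // div1r -natrX -lt0n.
exact.
Qed.

(** Completing the square gives [(x + 1/2) ^+ 2 + 3/4]. *)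
Lemma addr_sqr_add1_gt0 (F : realFieldType) (x : F) : 0 < x + (x ^+ 2 + 1).
Proof. by have := sqr_ge0 (x + 2^-1); rewrite sqrrD; lra. Qed.

Lemma positive_rat_padic_approx p (p_pr : prime p) (q e : rat) : 0 < e ->
  exists2 r : rat, 0 < r & padic_abs p (q - r) < e.
Proof.
move=> e0; pose c := padic_abs p (q ^+ 2 + 1).
have ce : 0 <= c / e by rewrite divr_ge0 ?padic_abs_ge0 // ltW.
(* The shift [p ^ k * (q ^ 2 + 1)] has [p]-adic size [c / p ^ k], which is below [e] once [p ^ k]
   exceeds [c / e]; [k < p ^ k] makes an Archimedean bound for [c / e] large enough. *)
pose k := Num.bound (c / e).
have ck : c / e < p%:R ^+ k.
  rewrite (lt_trans (archi_boundP ce)) // -natrX ltr_nat.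
  by rewrite ltn_expl // prime_gt1.
have pk1 : 1 <= p%:R ^+ k :> rat by rewrite exprn_ege1 // ler1n prime_gt0.
have pk0 : 0 < p%:R ^+ k :> rat by rewrite (lt_le_trans ltr01).
exists (q + p%:R ^+ k * (q ^+ 2 + 1)).
  have q1 : 0 <= q ^+ 2 + 1 by rewrite addr_ge0 // sqr_ge0.
  (* As [p ^ k >= 1], the shift is at least [q ^ 2 + 1], which already makes [q] positive. *)
  have h : q ^+ 2 + 1 <= p%:R ^+ k * (q ^+ 2 + 1) by rewrite ler_peMl.
  apply: lt_le_trans (lerD (lexx q) h).
  exact: addr_sqr_add1_gt0.
rewrite opprD addrA subrr sub0r padic_absN // padic_absM // padic_abs_pX //.
by rewrite mulrC ltr_pdivrMr // mulrC -ltr_pdivrMr.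
Qed.

(** Rationals embed as constant sequences, which are subtracted termwise. *)
Lemma Qp_ratrB p (p_pr : prime p) (q r : rat) :
  ratr (q - r) = ratr q - ratr r :> Qp p_pr.
Proof.
rewrite -!Qp_class_rat -Qp_classN -Qp_classD; congr Qp_class.
exact: val_inj.
Qed.

Lemma dense_positive_rat p (p_pr : prime p) :
  dense [set (ratr q : Qp p_pr) | q in [set q : rat | 0 < q]].
Proof.
move=> O [x Ox] Oopen.
have /nbhs_ballP [e /= e0 xeO] : nbhs x O by exact: open_nbhs_nbhs.
have [q xq] := Qp_rat_approx x e0.
have [r r0 qr] := positive_rat_padic_approx _ p_pr q _ e0.
exists (ratr r); split; last by exists r.
apply: xeO; rewrite Qp_ballE /=.
(* By the ultrametric inequality both errors may be as large as [e], without halving. *)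
rewrite -[x - _](subrKA (ratr q)); apply: le_lt_trans (Qp_absD _ _) _.
by rewrite gt_max xq -Qp_ratrB Qp_abs_rat.
Qed.

Theorem theorem3p5 (R : realType) :
  exists A : set nat,
    [/\ A `<=` [set n | (0 < n)%N],
        asymptotic_density A (0 : R)
      & forall (p : nat) (p_pr : prime p),
          dense [set (ratr q : Qp p_pr) | q in ratio_set A]].
Proof.
exists scaled_fourth_powers; split.
- exact: scaled_fourth_powers_gt0.
- exact: density_scaled_fourth_powers.
- move=> p p_pr O O0 Oopen.
  have [x [Ox [q q0 qx]]] := dense_positive_rat p p_pr O O0 Oopen.
  by exists x; split=> //; exists q => //; exact: ratio_set_scaled_fourth_powers.
Qed.
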